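(* Let $R$ be a right nonsingular ring which is not a right V-ring and is not von Neumann regular. The following are equivalent. (1) Every simple right $R$-module is indigent or injective. (2) Every uniform right $R$-module with nonzero socle is indigent or injective. (3) Every indecomposable right $R$-module with nonzero socle is indigent or injective.
   Context: Rings are associative with identity. A module $M$ is called $N$-subinjective if for every module $K$ containing $N$ as a submodule, every homomorphism $N\to M$ extends to a homomorphism $K\to M$. The subinjectivity domain of $M$ is $\underline{\mathfrak{In}}^{-1}(M)=\{N : M \text{ is } N\text{-subinjective}\}$. A module $M$ is indigent if $\underline{\mathfrak{In}}^{-1}(M)$ is exactly the class of injective modules. A ring $R$ is a right V-ring if all simple right $R$-modules are injective. *)

(* Defs.v *)
From HB Require Import structures.
From mathcomp Require Import all_boot all_order all_algebra.
From mathcomp Require Import boolp classical_sets.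

Set Implicit Arguments.
Unset Strict Implicit.
Unset Printing Implicit Defensive.

Import GRing.Theory.

Local Open Scope ring_scope.
Local Open Scope classical_set_scope.

(* A right R-module is a left module over the converse ring R^c: for v in such
   a module and r : R, the product v r is written r *: v.  In particular the
   right regular module R_R is R^c^o, where r *: x is the product x * r of R. *)
Notation rmodType R := (lmodType R^c).

Section Modules.
Variable A : pzRingType.
Implicit Types M N K V : lmodType A.

Definition submodule V (S : set V) : Prop := submod_closed [in S].

Definition simple_submodule V (S : set V) : Prop :=
  [/\ submodule S, S <> [set 0] &
      forall T : set V, submodule T -> T `<=` S -> T = [set 0] \/ T = S].

Definition simple V : Prop := simple_submodule [set: V].

(* The sum of all simple submodules, as the set of finite sums of elements of
   simple submodules; it is [set 0] when there is no simple submodule. *)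
Definition socle V : set V :=
  [set v | exists2 s : seq V,
     (forall x, x \in s -> exists2 S : set V, simple_submodule S & S x) &
     v = \sum_(x <- s) x].

Definition essential V (S : set V) : Prop :=
  submodule S /\
  forall T : set V, submodule T -> T <> [set 0] -> S `&` T <> [set 0].

Definition uniform V : Prop :=
  [set: V] <> [set 0] /\
  forall S : set V, submodule S -> S <> [set 0] -> essential S.

Definition indecomposable V : Prop :=
  [set: V] <> [set 0] /\
  forall S T : set V, submodule S -> submodule T ->
    S `&` T = [set 0] -> [set x + y | x in S & y in T] = [set: V] ->
    S = [set 0] \/ T = [set 0].

(* The inclusion of N as a submodule of K is an arbitrary injective linear
   map i. *)
Definition subinjective M N : Prop :=
  forall (K : lmodType A) (i : {linear N -> K}), injective i ->
  forall f : {linear N -> M}, exists g : {linear K -> M},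
    forall x, g (i x) = f x.

Definition subinjectivity_domain M : lmodType A -> Prop :=
  fun N => subinjective M N.

Definition injective_module M : Prop :=
  forall (N K : lmodType A) (i : {linear N -> K}), injective i ->
  forall f : {linear N -> M}, exists g : {linear K -> M},
    forall x, g (i x) = f x.

Definition indigent M : Prop :=
  forall N, subinjectivity_domain M N <-> injective_module N.

Definition annihilator V (v : V) : set A^o := [set a | (a : A) *: v = 0].

Definition singular_submodule V : set V :=
  [set v | essential (annihilator v)].

End Modules.

Arguments socle {A} V _.
Arguments singular_submodule {A} V _.

Definition right_nonsingular (R : pzRingType) : Prop :=
  singular_submodule R^c^o = [set 0].

Definition right_V_ring (R : pzRingType) : Prop :=
  forall M : rmodType R, simple M -> injective_module M.

Definition von_neumann_regular (R : pzRingType) : Prop :=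
  forall a : R, exists x : R, a = a * x * a.

(* Main.v *)
Require Import Defs.
From HB Require Import structures.
From mathcomp Require Import all_boot all_order all_algebra.
From mathcomp Require Import boolp classical_sets functions.

(** The implications between simple, uniform and indecomposable modules are
    formal in one direction, since a simple module is uniform and a uniform
    module is indecomposable.  The content is that the hypothesis on simple
    modules controls every indecomposable module M with a simple submodule T.

    If T is injective, it is a nonzero summand of M, hence all of M.  Otherwise
    T is indigent, and two facts are combined.

    First, every linear map from an injective module E to T is zero
    ([indigent_simple_hom0]).  Indeed T is cyclic on each of its nonzero
    elements, so if one map E -> T is nonzero, every map from the ring to T
    factors through E, hence extends to every overmodule of the ring; indigence
    of T makes the ring self-injective.  But a nonsingular self-injective ring
    is von Neumann regular ([self_injective_regular]), which is excluded.
    Consequently a quotient X of an injective module also has no nonzero map to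
    T, so T is trivially X-subinjective, and indigence makes X injective
    ([indigent_simple_quotient_injective]).

    Secondly, suppose that M is N-subinjective for some N that is not injective.
    As T is indigent, some map f from N to T is nonzero.  Embed N in an injective
    module E ([enough_injectives]).  The map N -> T -> M extends to E, and the
    image of that extension is a nonzero injective submodule of M, hence M.
    So M is injective unless its subinjectivity domain consists of injective
    modules only.

    Enough injectives are obtained by coinduction from the abelian group Q/Z,
    which is injective over the integers by Baer's criterion.

    Everything is proved for left modules over a ring A; right R-modules are the
    case where A is the converse ring of R. *)

Set Implicit Arguments.
Unset Strict Implicit.
Unset Printing Implicit Defensive.

Import GRing.Theory Num.Theory.

Local Open Scope ring_scope.
Local Open Scope classical_set_scope.

(** * Submodules and linear maps *)

Section Submodules.
Variable A : pzRingType.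
Implicit Types U V M N K : lmodType A.

Lemma submoduleP V (S : set V) :
  submodule S <-> S 0 /\ forall a x y, S x -> S y -> S (a *: x + y).
Proof.
split=> [[S0 Slin]|[S0 Slin]]; first split.
- by move: S0; rewrite inE.
- by move=> a x y Sx Sy; have := Slin a x y; rewrite !inE; apply.
by split=> [|a x y]; rewrite !inE //; apply: Slin.
Qed.

Section Submodule.
Variables (V : lmodType A) (S : set V).
Hypothesis hS : submodule S.

Lemma submod0 : S 0. Proof. by have /submoduleP[] := hS. Qed.

Lemma submodD x y : S x -> S y -> S (x + y).
Proof.
by move=> Sx Sy; rewrite -[x]scale1r; have /submoduleP[_] := hS; apply.
Qed.

Lemma submodZ a x : S x -> S (a *: x).
Proof.
move=> Sx; rewrite -[_ *: _]addr0; have /submoduleP[S0] := hS; exact.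
Qed.

Lemma submodB x y : S x -> S y -> S (x - y).
Proof.
by move=> Sx Sy; apply: submodD => //; rewrite -scaleN1r; apply: submodZ.
Qed.

(** The proof of [submodule S] is an argument, so that the closure structure
    can be inferred from the head constant. *)
Definition submod_pred of submodule S : {pred V} := [in S].

HB.instance Definition _ := GRing.isSubmodClosed.Build A V (submod_pred hS)
  (GRing.submod_closed_semi hS).

Record submod := Submod { submod_val : V; _ : submod_val \in submod_pred hS }.

HB.instance Definition _ := [isSub for submod_val].
HB.instance Definition _ := [Choice of submod by <:].
HB.instance Definition _ := [SubChoice_isSubLmodule of submod by <:].

Lemma submodP (x : submod) : S (val x).
Proof. by have := valP x; rewrite inE. Qed.

Lemma submod_lift v : S v -> exists x : submod, val x = v.
Proof.
move=> Sv; have v_in : v \in submod_pred hS by rewrite inE.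
by exists (Submod v_in).
Qed.

End Submodule.

Lemma linear_ex U V (f : U -> V) :
  (forall a x y, f (a *: x + y) = a *: f x + f y) ->
  exists g : {linear U -> V}, forall x, g x = f x.
Proof.
move=> f_lin.
pose g : {linear U -> V} := HB.pack f (GRing.isLinear.Build A U V _ f f_lin).
by exists g.
Qed.

Lemma corestrict U V (S : set V) (hS : submodule S) (f : {linear U -> V}) :
  (forall x, S (f x)) ->
  exists g : {linear U -> submod hS}, forall x, val (g x) = f x.
Proof.
move=> fS; have [g0 g0E] := choice (fun x => submod_lift hS (fS x)).
have [|g gE] := @linear_ex _ _ g0; last by exists g => x; rewrite gE.
by move=> a x y; apply: val_inj; rewrite linearP/= !g0E linearP.
Qed.

Lemma image_submodule U V (f : {linear U -> V}) (S : set U) :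
  submodule S -> submodule (f @` S).
Proof.
move=> hS; apply/submoduleP; split.
  by exists 0; [exact: submod0|rewrite linear0].
move=> a _ _ [x Sx <-] [y Sy <-]; exists (a *: x + y); last by rewrite linearP.
by apply: submodD => //; apply: submodZ.
Qed.

Lemma preimage_submodule U V (f : {linear U -> V}) (S : set V) :
  submodule S -> submodule (f @^-1` S).
Proof.
move=> hS; apply/submoduleP; split; first by rewrite /= linear0; exact: submod0.
by move=> a x y /= Sx Sy; rewrite linearP; apply: submodD => //; apply: submodZ.
Qed.

Lemma setT_submodule V : submodule [set: V].
Proof. by apply/submoduleP. Qed.

Lemma zero_submodule V : submodule [set (0 : V)].
Proof. by apply/submoduleP; split=> // a x y /= -> ->; rewrite scaler0 addr0. Qed.

Lemma eq_zero_submodule V (S : set V) : submodule S ->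
  (forall x, S x -> x = 0) -> S = [set 0].
Proof.
move=> hS S0; apply/seteqP; split=> x; first exact: S0.
by move=> ->; apply: submod0.
Qed.

Lemma neq_zero_submodule V (S : set V) : submodule S -> S <> [set 0] ->
  exists2 x, S x & x <> 0.
Proof.
move=> hS S0; apply: contrapT => nS; apply: S0.
apply: eq_zero_submodule => // x Sx.
by apply: contrapT => x0; apply: nS; exists x.
Qed.

(** Zorn's lemma in the only form needed.  With D the annihilator of an element
    it yields a relative complement of D; with D the vertical axis of a product
    it yields a maximal partial linear map. *)
Lemma maximal_disjoint V (B D : set V) :
    submodule B -> B `&` D `<=` [set 0] ->
  exists S, [/\ submodule S, B `<=` S, S `&` D `<=` [set 0] &
    forall T, submodule T -> S `<=` T -> T `&` D `<=` [set 0] -> T `<=` S].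
Proof.
move=> hB BD.
pose Q S := [/\ submodule S, B `<=` S & S `&` D `<=` [set 0]].
(* the union of the empty chain is set0, which is not a submodule: adding B
   to every set makes that union satisfy the condition as well *)
have [|S [QS maxS]] := @Zorn_bigcup V (fun S => Q (S `|` B)).
  move=> F FQ totF; split.
  - apply/submoduleP; split; first by right; apply: submod0.
    move=> a x y xF yF.
    have [X FX [Xx Xy]] : exists2 X, F X \/ X = B & (X `|` B) x /\ (X `|` B) y.
      case: xF yF => [[X FX Xx]|Bx] [[Y FY Yy]|By].
      - have [XY|YX] := totF _ _ FX FY.
        + by exists Y; [left|split; left => //; apply: XY].
        + by exists X; [left|split; left => //; apply: YX].
      - by exists X; [left|split; [left|right]].
      - by exists Y; [left|split; [right|left]].
      - by exists B; [right|split; right].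
    have hX : submodule (X `|` B).
      by case: FX => [/FQ[]//|->]; rewrite setUid.
    have : (X `|` B) (a *: x + y) by apply: submodD => //; apply: submodZ.
    case: FX => [FX|->]; last by rewrite setUid => ?; right.
    by case=> [Xz|?]; [left; exists X|right].
  - by move=> x Bx; right.
  - move=> x [[[X FX Xx]|Bx] Dx]; last exact: BD.
    by have [_ _ XD] := FQ _ FX; apply: XD; split=> //; left.
exists (S `|` B); case: QS => hS _ SD; split=> //.
move=> T hT ST TD x Tx; apply: contrapT => Sx; apply: (maxS T).
  split=> [y Sy|TS]; first by apply: ST; left.
  by apply: Sx; left; apply: TS.
suff -> : T `|` B = T by split=> // y By; apply: ST; right.
by apply/seteqP; split=> y; [case=> // By; apply: ST; right|left].
Qed.

End Submodules.

(** The group V seen as a module over the integers. *)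
Local Notation "V ^z" := (zmodule V) (at level 2, format "V ^z") : type_scope.

(** * Injectivity by Baer's criterion *)

Section Baer.
Variable A : pzRingType.
Implicit Types U V M N K : lmodType A.

(** A linear map from a submodule of U to V, encoded by its graph. *)
Definition partial_linear U V (G : set (U * V)) : Prop :=
  submodule G /\ forall y, G (0, y) -> y = 0.

Lemma partial_linear_total U V (G : set (U * V)) : partial_linear G ->
    (forall x, exists y, G (x, y)) ->
  exists g : {linear U -> V}, forall x y, G (x, y) -> y = g x.
Proof.
move=> [hG G0] totG; have [g0 g0G] := choice totG.
have G_fun x y z : G (x, y) -> G (x, z) -> y = z.
  move=> Gy Gz; apply: subr0_eq; apply: G0.
  by rewrite -(subrr x); apply: (submodB hG Gy Gz).
have [a x y|g gE] := @linear_ex _ _ _ g0.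
  apply: G_fun (g0G _) _.
  exact: (submodD hG (submodZ hG a (g0G x)) (g0G y)).
by exists g => x y Gxy; rewrite gE; apply: G_fun Gxy _.
Qed.

(** Baer's condition: every linear map from a left ideal to M is the restriction
    of one from the ring, that is, of right multiplication by an element of M. *)
Definition baer M : Prop := forall G : set (A^o * M), partial_linear G ->
  exists m, forall a c, G (a, c) -> c = (a : A) *: m.

(** A maximal partial linear map is everywhere defined: at a point x, Baer's
    condition provides a value compatible with those already fixed on the
    multiples of x. *)
Lemma baer_extend M K (G0 : set (K * M)) : baer M -> partial_linear G0 ->
  exists g : {linear K -> M}, forall x y, G0 (x, y) -> y = g x.
Proof.
move=> bM [hG0 G00].
have [|G [hG G0G Gfun maxG]] :=
  @maximal_disjoint A _ G0 [set xy | xy.1 = 0] hG0.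
  by move=> [x y] [/= Gxy x0]; move: Gxy; rewrite x0 => /G00 ->.
have G_0 y : G (0, y) -> y = 0.
  by move=> Gy; have [] : [set (0 : K * M)%type] (0, y) by apply: Gfun.
suff totG x : exists y, G (x, y).
  have [g gE] := partial_linear_total (conj hG G_0) totG.
  by exists g => x y /G0G; apply: gE.
(* G composed with a |-> a *: x is a partial linear map on the ring; any m that
   represents it can be taken as the value at x *)
have [|m mE] := bM [set ac | G ((ac.1 : A) *: x, ac.2)].
  split=> [|c]; last by rewrite /= scale0r; apply: G_0.
  apply/submoduleP; split=> [|a u v Gu Gv].
    by rewrite /= scale0r; apply: (submod0 hG).
  rewrite /= scalerDl -scalerA.
  exact: (submodD hG (submodZ hG a Gu) Gv).
pose G1 := [set z | exists2 b, G b & exists a : A, z = b + a *: (x, m)].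
exists m; apply: (maxG G1);
  last by exists 0; [apply: (submod0 hG)|exists 1; rewrite scale1r add0r].
- apply/submoduleP; split.
    by exists 0; [apply: (submod0 hG)|exists 0; rewrite scale0r addr0].
  move=> r _ _ [b Gb [a ->]] [b' Gb' [a' ->]].
  exists (r *: b + b'); first exact: (submodD hG (submodZ hG r Gb) Gb').
  exists (r * a + a'); rewrite scalerDr scalerDl scalerA.
  by rewrite -!addrA; congr (_ + _); rewrite addrCA.
- by move=> z Gz; exists z => //; exists 0; rewrite scale0r addr0.
- move=> _ [[[u v] Guv [a ->]] /= ux].
  have au : - a *: x = u by apply/eqP; rewrite scaleNr eq_sym -addr_eq0 ux.
  have /mE /= vE : [set ac | G ((ac.1 : A) *: x, ac.2)] (- a, v).
    by rewrite /= au.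
  suff -> : (u, v) + a *: (x, m) = 0 by [].
  by rewrite vE -au; congr (_, _); rewrite /= scaleNr addNr.
Qed.

Lemma baer_injective M : baer M -> injective_module M.
Proof.
move=> bM N K i i_inj f.
have [|g gE] :=
  @baer_extend _ _ [set xy : K * M | exists n, xy = (i n, f n)] bM; last first.
  by exists g => n; symmetry; apply: gE; exists n.
split=> [|_ [n [/esym n0 ->]]]; last first.
  by rewrite -[RHS](linear0 f); congr (f _); apply: i_inj; rewrite n0 linear0.
apply/submoduleP; split; first by exists 0; rewrite !linear0.
by move=> a _ _ [x ->] [y ->]; exists (a *: x + y); rewrite !linearP.
Qed.

End Baer.

Lemma additive_int_linear (U V : zmodType) (f : U -> V) :
  zmod_morphism f -> exists g : {linear U^z -> V^z}, forall x, g x = f x.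
Proof.
move=> f_add; pose h : {additive U -> V} :=
  HB.pack f (GRing.isZmodMorphism.Build U V f f_add).
apply: (@linear_ex int U^z V^z f) => k x y.
exact: etrans (raddfD h _ _) (congr1 (+%R^~ _) (raddfMz h k x)).
Qed.

(** * Q/Z as an injective cogenerator of abelian groups *)

Lemma int_submodule_principal (I : set int^o) : submodule I ->
  exists d : int, forall k : int, I k <-> (d %| k)%Z.
Proof.
move=> hI.
have [[n I_n n0]|I0] := pselect (exists2 n : nat, I n%:Z & (0 < n)%N); last first.
  exists 0 => k; split=> [Ik|]; last first.
    by rewrite dvd0z => /eqP ->; apply: (submod0 hI).
  rewrite dvd0z -absz_eq0; apply/negP => /negP; rewrite -lt0n => k0; apply: I0.
  exists `|k|%N => //; have := submodZ hI (sgz k) Ik.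
  by rewrite /GRing.scale /= abszEsg.
have exP : exists m : nat, `[< I m%:Z /\ (0 < m)%N >] by exists n; apply/asboolP.
case: (ex_minnP exP) => d /asboolP[Id d0] dmin.
exists d%:Z => k; split=> [Ik|/dvdzP[q ->]].
  have d_neq0 : d%:Z != 0 by rewrite eqz_nat -lt0n.
  have Ir : I (k %% d%:Z)%Z.
    have -> : (k %% d%:Z)%Z = k - (k %/ d%:Z)%Z * d%:Z by [].
    exact: (submodB hI Ik (submodZ hI _ Id)).
  apply/dvdz_mod0P; move: Ir (modz_ge0 k d_neq0) (ltz_pmod k (d := d%:Z)).
  case: (k %% d%:Z)%Z => // r Ir _ /(_ d0) rd.
  have [->//|r0] := posnP r.
  by have := dmin r (asboolT (conj Ir r0)); rewrite leqNgt -ltz_nat rd.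
exact: (submodZ hI q Id).
Qed.

(** A map from the ideal generated by d is represented by any d-th part of its
    value at d. *)
Lemma divisible_baer (G : zmodType) :
    (forall (k : int) (g : G), k != 0 -> exists h, h *~ k = g) ->
  @baer int G^z.
Proof.
move=> divG Gr [hGr Gr0].
have [|d dP] := @int_submodule_principal [set k | exists c, Gr (k, c)].
  apply/submoduleP; split; first by exists 0; apply: (submod0 hGr).
  move=> a x y [c Gc] [c' Gc']; exists (a *: c + c').
  exact: (submodD hGr (submodZ hGr a Gc) Gc').
have [c0 Gc0] : exists c, Gr (d, c) by apply/dP.
have [m mE] : exists m : G, m *~ d = c0.
  have [d0|/divG//] := eqVneq d 0; exists 0; rewrite d0 mulr0z.
  by rewrite (Gr0 c0) // -d0.
exists m => a c Gac; have /dvdzP[q aE] : (d %| a)%Z by apply/dP; exists c.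
apply/eqP; rewrite -subr_eq0; apply/eqP; apply: Gr0.
have := submodB hGr Gac (submodZ hGr q Gc0).
rewrite aE -mE; congr (Gr (_, _)); first exact: subrr.
by rewrite /= scalezrE scalezrE -mulrzA [d * q]mulrC.
Qed.

Definition QZ : zmodType := Quotient.quot (@Num.int_num_subdef rat : {pred rat}).

Local Open Scope quotient_scope.

Lemma QZ_divisible (k : int) (g : QZ) : k != 0 -> exists h, h *~ k = g.
Proof.
move=> k0; exists (\pi_QZ (repr g / k%:~R)).
by rewrite -raddfMz -mulrzr divfK ?intr_eq0//= reprK.
Qed.

Lemma pi_QZ_eq0 (x : rat) : (\pi_QZ x == 0) = (x \is a Num.int).
Proof.
by rewrite -[0](raddf0 (\pi_QZ)) -Quotient.idealrBE subr0.
Qed.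

Lemma QZ_baer : @baer int QZ^z.
Proof. exact: divisible_baer QZ_divisible. Qed.

(** The cyclic group generated by x is mapped to Q/Z by sending x to the class of
    1/e, where e is the order of x, or 2 if that order is infinite; the map
    extends because Q/Z is injective. *)
Lemma QZ_separates (X : lmodType int) (x : X) : x <> 0 ->
  exists chi : {linear X -> QZ^z}, chi x <> 0.
Proof.
move=> x0; have [|d dP] := @int_submodule_principal [set k : int | k *: x = 0].
  apply/submoduleP; split=> [|a k l /= kx lx]; first exact: scale0r.
  by rewrite scalerDl -scalerA kx scaler0 lx addr0.
have d_unit : ~~ (d %| 1)%Z.
  by apply/negP => /dP /=; rewrite scale1r.
(* d generates the ideal of integers killing x, and d = 0 means infinite order *)
pose e := if d == 0 then 2%:Z else d.
have [e0 e_unit de] :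
    [/\ e != 0, ~~ (e %| 1)%Z & forall k, (d %| k)%Z -> (e %| k)%Z].
  rewrite /e; case: (eqVneq d 0) => [->|d0]; split=> // k.
  by rewrite dvd0z => /eqP ->; rewrite dvdz0.
pose g : QZ := \pi_QZ (e%:~R^-1).
have kg k : k *: x = 0 -> g *~ k = 0.
  move=> /dP/de ek; apply/eqP; rewrite -raddfMz pi_QZ_eq0 -mulrzl.
  exact: Qint_dvdz.
have [|chi chiE] := @baer_extend _ _ _
    [set z | exists k : int, z = k *: (x, g : QZ^z)] QZ_baer.
  split=> [|c [k [/esym kx ->]]]; last exact: kg.
  apply/submoduleP; split; first by exists 0; rewrite scale0r.
  by move=> a _ _ [k ->] [l ->]; exists (a * k + l); rewrite scalerDl scalerA.
exists chi; rewrite -(chiE x g); last by exists 1; rewrite scale1r.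
move/eqP; rewrite pi_QZ_eq0 => /intrP[m em]; case/negP: e_unit.
apply/dvdzP; exists m; apply: (@intr_inj rat).
by rewrite rmorphM /= -em mulVf ?intr_eq0.
Qed.

(** * Coinduced modules and enough injectives *)

Section Coinduced.
Variables (A : pzRingType) (T : Type) (G : zmodType).

Definition valuewise_additive : {pred T -> A -> G} :=
  [pred phi | `[< forall t a b, phi t (a - b) = phi t a - phi t b >]].

Fact valuewise_additive_closed : zmod_closed valuewise_additive.
Proof.
split=> [|phi psi /asboolP phiB /asboolP psiB]; apply/asboolP => t a b.
  by rewrite subr0.
rewrite /= !fctE phiB psiB !opprB addrACA [RHS]addrACA.
by rewrite [- phi t b - _]addrC.
Qed.

HB.instance Definition _ :=
  GRing.isZmodClosed.Build (T -> A -> G) valuewise_additive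
    valuewise_additive_closed.

(** The T-indexed power of the module Hom_Z(A, G): a single family of additive
    maps avoids a separate product construction.  The ring acts by right
    translation of the argument, which makes this a left module. *)
Record coinduced := Coinduced
  { coinduced_val : T -> A -> G; _ : coinduced_val \in valuewise_additive }.

HB.instance Definition _ := [isSub for coinduced_val].
HB.instance Definition _ := [Choice of coinduced by <:].
HB.instance Definition _ := [SubChoice_isSubZmodule of coinduced by <:].

Lemma coinducedB (phi : coinduced) t a b :
  val phi t (a - b) = val phi t a - val phi t b.
Proof. by have /asboolP := valP phi; apply. Qed.

Lemma coinduced0 (phi : coinduced) t : val phi t 0 = 0.
Proof. by rewrite -(subrr (0 : A)) coinducedB subrr. Qed.

Lemma coinducedD (phi : coinduced) t a b :
  val phi t (a + b) = val phi t a + val phi t b.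
Proof.
by rewrite -{1}[b]opprK coinducedB -[- b]sub0r coinducedB coinduced0 sub0r opprK.
Qed.

Definition coinduced_of (phi : T -> A -> G)
    (phiB : forall t a b, phi t (a - b) = phi t a - phi t b) : coinduced :=
  Coinduced (asboolT phiB : phi \in valuewise_additive).

Fact coinduced_scale_subproof a (phi : coinduced) t b c :
  val phi t ((b - c) * a) = val phi t (b * a) - val phi t (c * a).
Proof. by rewrite mulrBl coinducedB. Qed.

Definition coinduced_scale a phi := coinduced_of (coinduced_scale_subproof a phi).

Fact coinduced_scaleA a b phi :
  coinduced_scale a (coinduced_scale b phi) = coinduced_scale (a * b) phi.
Proof. by apply/val_inj/funext => t; apply/funext => c /=; rewrite mulrA. Qed.

Fact coinduced_scale1 : left_id 1 coinduced_scale.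
Proof.
by move=> phi; apply/val_inj/funext => t; apply/funext => c /=; rewrite mulr1.
Qed.

Fact coinduced_scaleDr : right_distributive coinduced_scale +%R.
Proof. by move=> a phi psi; apply/val_inj. Qed.

Fact coinduced_scaleDl phi : {morph coinduced_scale^~ phi : a b / a + b}.
Proof.
move=> a b; apply/val_inj/funext => t; apply/funext => c.
by rewrite /= mulrDr coinducedD.
Qed.

HB.instance Definition _ := GRing.Zmodule_isLmodule.Build A coinduced
  coinduced_scaleA coinduced_scale1 coinduced_scaleDr coinduced_scaleDl.

Lemma coinducedZ a (phi : coinduced) t b : val (a *: phi) t b = val phi t (b * a).
Proof. by []. Qed.

(** One direction of the adjunction between coinduction and restriction to the
    integers. *)
Lemma to_coinduced (Y : lmodType A) (e : T -> {linear Y^z -> G^z}) :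
  exists g : {linear Y -> coinduced},
    forall y t a, val (g y) t a = e t (a *: y).
Proof.
have eB (y : Y) t (a b : A) : e t ((a - b) *: y) = e t (a *: y) - e t (b *: y).
  by rewrite scalerBl; apply: (linearB (e t)).
have [|g gE] := @linear_ex _ _ _ (fun y : Y => coinduced_of (eB y) : coinduced).
  move=> a x y; apply/val_inj/funext => t; apply/funext => b.
  by rewrite /= scalerDr scalerA; apply: (linearD (e t)).
by exists g => y t a; rewrite gE.
Qed.

(** Coinduction is right adjoint to the restriction of scalars, which preserves
    injective maps; hence it sends injective groups to injective modules. *)
Lemma coinduced_injective : @baer int G^z -> injective_module coinduced.
Proof.
move=> bG X Y i i_inj f.
have ext t : exists e : {linear Y^z -> G^z}, forall x, e (i x) = val (f x) t 1.
  have [x y|fz fzE] := @additive_int_linear X G (fun x => val (f x) t 1).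
    by rewrite linearB.
  have [iz izE] := additive_int_linear (linearB i).
  have [x y|e eE] := @baer_injective int G^z bG X^z Y^z iz _ fz.
    by rewrite !izE => /i_inj.
  by exists e => x; rewrite -izE eE fzE.
have [e eE] := choice ext; have [g gE] := to_coinduced e.
exists g => x; apply/val_inj/funext => t; apply/funext => a.
by rewrite gE -linearZ eE linearZ coinducedZ mul1r.
Qed.

End Coinduced.

(** N embeds in the power of Hom_Z(A, Q/Z) indexed by N itself, where the factor
    at n carries a character that does not vanish at n. *)
Theorem enough_injectives (A : pzRingType) (N : lmodType A) :
  exists (E : lmodType A) (j : {linear N -> E}),
    injective j /\ injective_module E.
Proof.
have sep n : exists chi : {linear N^z -> QZ^z}, n <> 0 -> chi n <> 0.
  have [->|n0] := pselect (n = 0); first by exists \0.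
  by have [chi] := @QZ_separates N^z n n0; exists chi.
have [chi chiP] := choice sep; have [j jE] := to_coinduced chi.
exists (coinduced A N QZ), j; split; last exact: coinduced_injective QZ_baer.
apply: raddf_inj => n jn0; apply: contrapT => /chiP; apply.
by rewrite -[n]scale1r -jE jn0.
Qed.

(** * Indigent simple modules *)

Section Indigence.
Variable A : pzRingType.
Implicit Types M N K E T V : lmodType A.

Lemma simple_submod V (S : set V) (hS : submodule S) :
  simple_submodule S -> simple (submod hS).
Proof.
move=> [_ S0 Smin]; split=> [||X hX _]; first exact: setT_submodule.
  move=> all0; apply: S0; apply: eq_zero_submodule => // x Sx.
  have [y <-] := submod_lift hS Sx.
  by have -> : y = 0 by [have : [set: submod hS] y by []; rewrite all0].
have hI : submodule ((val : submod hS -> V) @` X) by apply: image_submodule.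
have [|I0|IS] := Smin _ hI; first by move=> _ [y _ <-]; apply: submodP.
- left; apply: eq_zero_submodule => // y Xy; apply: val_inj.
  by have : [set val y | y in X] (val y) by [exists y]; rewrite I0.
- right; apply/seteqP; split=> // y _.
  have [z Xz /val_inj <- //] : [set val x | x in X] (val y).
  by rewrite IS; apply: submodP.
Qed.

Lemma simple_cyclic T (t s : T) : simple T -> t <> 0 -> exists a : A, s = a *: t.
Proof.
move=> [_ _ Tmin] t0; pose X := [set x : T | exists a : A, x = a *: t].
have hX : submodule X.
  apply/submoduleP; split; first by exists 0; rewrite scale0r.
  by move=> a _ _ [b ->] [c ->]; exists (a * b + c); rewrite scalerDl scalerA.
have [//|X0|XT] := Tmin X hX.
  by case: t0; have : X t by [exists 1; rewrite scale1r]; rewrite X0.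
by have : X s by rewrite XT.
Qed.

Lemma simple_target_surjective T N (f : {linear N -> T}) x :
  simple T -> f x <> 0 -> forall s, exists y, f y = s.
Proof.
move=> simT fx s; have [a ->] := simple_cyclic s simT fx.
by exists (a *: x); rewrite linearZ.
Qed.

Lemma subinjective_of_injective M N : injective_module N -> subinjective M N.
Proof.
move=> injN K i i_inj f; have [r rE] := injN _ _ _ i_inj idfun.
by exists (f \o r) => x /=; rewrite rE.
Qed.

(** The image of an injective module X splits off M, and the complement vanishes
    because M is indecomposable. *)
Lemma indecomposable_injective M (X : lmodType A) (j : {linear X -> M}) :
    indecomposable M -> injective_module X -> injective j ->
    (exists x : X, x <> 0) ->
  injective_module M.
Proof.
move=> [_ indM] injX j_inj [x0 x0_neq0].
have [p pj] := injX _ _ _ j_inj idfun.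
have p_inj : forall y, p y = 0 -> y = 0.
  have [| | | |X0|ker0] := indM (range j) (p @^-1` [set 0]).
  - by apply: image_submodule; apply: setT_submodule.
  - by apply: preimage_submodule; apply: zero_submodule.
  - apply/seteqP; split=> [_ [[x _ <-]] /=|_ ->]; last first.
      by split; [exists 0; rewrite ?linear0|rewrite /= linear0].
    by rewrite pj /= => ->; rewrite linear0.
  - apply/seteqP; split=> // y _; exists (j (p y)); first by exists (p y).
    exists (y - j (p y)); last by rewrite addrC subrK.
    by rewrite /= linearB pj subrr.
  - case: x0_neq0; apply: j_inj; rewrite linear0.
    by have : range j (j x0) by [exists x0]; rewrite X0.
  - by move=> y py; have : (p @^-1` [set 0]) y by []; rewrite ker0.
move=> N K i i_inj f; have [g gE] := injX _ _ _ i_inj (p \o f).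
exists (j \o g) => x; apply/subr0_eq/p_inj.
by rewrite linearB /= pj gE subrr.
Qed.

(** Let C be a relative complement of the annihilator of a.  Right
    multiplication by a is injective on C, so self-injectivity extends its
    inverse Ca -> C to right multiplication by some b.  Then aba - a is killed by C and by the annihilator
    of a, whose sum is essential; hence it is singular, and so zero. *)
Lemma self_injective_regular :
    singular_submodule A^o = [set 0] -> injective_module A^o ->
  forall a : A, exists b : A, a = a * b * a.
Proof.
move=> nonsing injA a.
have ann_submodule (x : A^o) : submodule (annihilator x).
  apply/submoduleP; split=> [|r u v /= ux vx]; first exact: scale0r.
  by rewrite /annihilator /= scalerDl -scalerA ux scaler0 vx addr0.
have [C [hC _ Ca maxC]] :=
  @maximal_disjoint A A^o [set 0] (annihilator (a : A^o))
  (@zero_submodule _ _) (@subIsetl _ _ _).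
have [|mul_a mul_aE] := @linear_ex A (submod hC) A^o (fun c => val c * a).
  by move=> r c d; rewrite linearP /= mulrDl -mulrA.
have [|g gE] := injA _ _ mul_a _ val.
  apply: raddf_inj => c ca0; apply: val_inj.
  by apply: Ca; split; [apply: submodP|rewrite /annihilator /= -[LHS]mul_aE].
pose b : A := g 1; exists b; apply/esym/subr0_eq.
(* it remains to see that aba - a is singular *)
set x : A^o := _ - _; suff : singular_submodule A^o x by rewrite nonsing.
have C_x c : C c -> annihilator x c.
  move=> Cc; have [c' c'E] := submod_lift hC Cc.
  have cab : c * a * b = c.
    by rewrite -{2}c'E -gE mul_aE c'E -[c * a]mulr1 (linearZ_LR g) mulr1.
  by change (c * (a * b * a - a) = 0); rewrite mulrBr !mulrA cab subrr.
have a_x c : annihilator (a : A^o) c -> annihilator x c.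
  move=> ca; change (c * (a * b * a - a) = 0).
  by rewrite mulrBr !mulrA (ca : c * a = 0) !mul0r subrr.
split; first exact: ann_submodule.
move=> T hT T0 xT; apply: T0; apply: eq_zero_submodule => // t Tt.
have xT0 u : annihilator x u -> T u -> u = 0.
  by move=> xu Tu; have : (annihilator x `&` T) u by []; rewrite xT.
(* otherwise T could be added to C without meeting the annihilator of a *)
suff /C_x/xT0 -> : C t by [].
apply: (maxC [set u + v | u in C & v in T]).
- apply/submoduleP; split.
    by exists 0; [exact: submod0|exists 0; [exact: submod0|rewrite addr0]].
  move=> r _ _ [u Cu [v Tv <-]] [u' Cu' [v' Tv' <-]].
  exists (r *: u + u'); first exact: (submodD hC (submodZ hC r Cu) Cu').
  exists (r *: v + v'); first exact: (submodD hT (submodZ hT r Tv) Tv').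
  by rewrite scalerDr addrACA.
- by move=> u Cu; exists u => //; exists 0; [exact: submod0|rewrite addr0].
- move=> _ [[u Cu [v Tv <-]] uva].
  have v0 : v = 0.
    apply: xT0 => //; rewrite -[v](addKr u) addrC.
    by apply: (submodB (ann_submodule x) (a_x _ uva) (C_x _ Cu)).
  by move: uva; rewrite v0 addr0 => uva; apply: Ca.
- by exists 0; [exact: submod0|exists t; rewrite ?add0r].
Qed.

(** A nonzero h is onto the simple module T.  Every map f from the ring to T then
    factors through E, by sending 1 to some a in E with h a = f 1.  Since E
    is injective, f extends to every overmodule, so the ring is in the
    subinjectivity domain of T. *)
Lemma indigent_simple_hom0 T E (h : {linear E -> T}) :
    ~ injective_module (A^o : lmodType A) -> simple T -> indigent T ->
  injective_module E -> forall e, h e = 0.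
Proof.
move=> ninjA simT indT injE e; apply: contrapT => he; apply: ninjA.
apply/(indT A^o) => K i i_inj f.
have [a fa] := simple_target_surjective simT he (f 1).
have [|phi phiE] := @linear_ex A A^o E (fun r => r *: a).
  by move=> r u v; rewrite scalerDl -scalerA.
have [psi psiE] := injE _ _ _ i_inj phi.
exists (h \o psi) => r /=; rewrite psiE phiE linearZ fa.
by rewrite -linearZ_LR; congr (f _); apply: mulr1.
Qed.

(** There is no nonzero map from the image of E to T, so T is subinjective
    relative to it for want of maps to extend. *)
Lemma indigent_simple_quotient_injective T E M (g : {linear E -> M})
    (hg : submodule (range g)) :
    ~ injective_module (A^o : lmodType A) -> simple T -> indigent T ->
  injective_module E -> injective_module (submod hg).
Proof.
move=> ninjA simT indT injE; apply/(indT _) => K i i_inj f.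
have [|g' g'E] := @corestrict A _ _ _ hg g; first by move=> x; exists x.
exists \0 => y; have [e _ ge] := submodP y.
have -> : y = g' e by apply: val_inj; rewrite g'E.
exact/esym/(indigent_simple_hom0 (f \o g') ninjA simT indT injE).
Qed.

Lemma socle_simple_submodule V : socle V <> [set 0] ->
  exists S : set V, simple_submodule S.
Proof.
move=> soc0; apply: contrapT => noS; apply: soc0; apply/seteqP; split.
  move=> v [s sS ->]; rewrite big_seq big1 // => x /sS[S simS _].
  by case: noS; exists S.
by move=> v ->; exists [::]; rewrite ?big_nil.
Qed.

Theorem indecomposable_indigent_or_injective M :
    ~ injective_module (A^o : lmodType A) ->
    (forall T, simple T -> indigent T \/ injective_module T) ->
  indecomposable M -> socle M <> [set 0] -> indigent M \/ injective_module M.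
Proof.
move=> ninjA simP indM /socle_simple_submodule[S simS].
have hS : submodule S by case: simS.
have [s Ss s0] : exists2 s, S s & s <> 0.
  by apply: neq_zero_submodule => //; case: simS.
have simT := simple_submod hS simS.
have [indT|injT] := simP _ simT; last first.
  right; apply: indecomposable_injective indM injT val_inj _.
  have [t tE] := submod_lift hS Ss.
  by exists t => t0; apply: s0; rewrite -tE t0.
have [injM|ninjM] := pselect (injective_module M); [by right|left].
move=> N; split=> [domN|]; last exact: subinjective_of_injective.
apply: contrapT => ninjN; apply: ninjM.
(* otherwise N would lie in the subinjectivity domain of T *)
have [f [x fx]] : exists f : {linear N -> submod hS}, exists x, f x <> 0.
  apply: contrapT => f0; apply: ninjN; apply/(indT N) => K i i_inj f.
  exists \0 => x; apply/esym; apply: contrapT => fx.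
  by apply: f0; exists f, x.
have [E [j [j_inj injE]]] := enough_injectives N.
have [g gE] := domN E j j_inj (val \o f).
have hg : submodule (range g) by apply: image_submodule; apply: setT_submodule.
have injX := indigent_simple_quotient_injective (hg := hg) ninjA simT indT injE.
apply: indecomposable_injective indM injX val_inj _.
have [y yE] : exists y : submod hg, val y = g (j x).
  by apply: submod_lift; exists (j x).
exists y => y0; apply: fx; apply: val_inj.
by rewrite raddf0 -[LHS](gE x) -yE y0.
Qed.

Lemma uniform_indecomposable M : uniform M -> indecomposable M.
Proof.
move=> [M0 unif]; split=> // S T hS hT ST _.
have [->|S0] := pselect (S = [set 0]); [by left|right].
apply: contrapT => T0; have [_ /(_ T hT T0)] := unif S hS S0.
by rewrite ST.
Qed.

Lemma simple_uniform M : simple M -> uniform M.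
Proof.
move=> [_ M0 Mmin]; split=> // S hS S0.
have [//|//|->] := Mmin S hS; split; first exact: setT_submodule.
by move=> T _ T0; rewrite setTI.
Qed.

Lemma simple_socle M : simple M -> socle M <> [set 0].
Proof.
move=> simM soc0; have [hM M0 _] := simM; apply: M0.
apply: eq_zero_submodule => // x _; suff : socle M x by rewrite soc0.
exists [:: x]; last by rewrite big_seq1.
by move=> y _; exists [set: M].
Qed.

End Indigence.

Theorem proposition20 (R : pzRingType)
  (R_nonsingular : right_nonsingular R)
  (R_not_V : ~ right_V_ring R)
  (R_not_regular : ~ von_neumann_regular R) :
  [<-> (forall M : rmodType R, simple M -> indigent M \/ injective_module M);
       (forall M : rmodType R, uniform M -> socle M <> [set 0] ->
          indigent M \/ injective_module M);
       (forall M : rmodType R, indecomposable M -> socle M <> [set 0] ->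
          indigent M \/ injective_module M)].
Proof.
have ninjR : ~ injective_module (R^c^o : rmodType R).
  move=> injR; apply: R_not_regular => a.
  have [b ab] := self_injective_regular R_nonsingular injR (a : R^c).
  by exists b; rewrite {1}ab -mulrA.
have simple_to_indecomposable :=
  @indecomposable_indigent_or_injective R^c _ ninjR.
tfae=> [simP M /uniform_indecomposable|unifP M|indecP M simM].
- exact: simple_to_indecomposable.
- apply: simple_to_indecomposable => T simT.
  by apply: unifP; [exact: simple_uniform|exact: simple_socle].
- apply: indecP; last exact: simple_socle.
  exact/uniform_indecomposable/simple_uniform.
Qed.
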